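(* Suppose that every hereditary graph class admitting strongly sublinear $\alpha$-separators is fractionally $\mathsf{tree}\text{-}\alpha$-fragile. Then every hereditary graph class admitting strongly sublinear separators is fractionally $\mathsf{tw}$-fragile.
   Context: All graphs are finite, simple and (unless stated otherwise) nonempty; $\mathbb N$ is the set of positive integers. A graph class is hereditary if it is closed under taking induced subgraphs. A balanced separator of $G$ is a set $S\subseteq V(G)$ such that every connected component of $G-S$ has at most $2|V(G)|/3$ vertices. $\mathsf{sep}(G)$ is the minimum of $|S|$, and $\mathsf{sep}\text{-}\alpha(G)$ the minimum of $\alpha(G[S])$ (independence number), over balanced separators $S$ of $G$. A class $\mathcal C$ admits strongly sublinear separators (resp. strongly sublinear $\alpha$-separators) if there are constants $c\ge 1$, $\varepsilon>0$ such that $\mathsf{sep}(G)\le c|V(G)|^{1-\varepsilon}$ (resp. $\mathsf{sep}\text{-}\alpha(G)\le c|V(G)|^{1-\varepsilon}$) for every $G\in\mathcal C$. $\mathsf{tw}(G)$ is treewidth, and the tree-independence number $\mathsf{tree}\text{-}\alpha(G)$ is the minimum over all tree decompositions of $G$ of the maximum of $\alpha(G[X])$ over all bags $X$. Let $p\in\{\mathsf{tw},\mathsf{tree}\text{-}\alpha\}$. For $0\le\beta\le 1$, a $\beta$-general cover of $G$ is a nonempty finite multiset $\mathcal A$ of subsets of $V(G)$ such that each vertex belongs to at least $\beta|\mathcal A|$ elements of $\mathcal A$ (counted with multiplicity). Its $p$-width is $\max_{A\in\mathcal A}p(G[A])$ (the empty graph contributes value $0$). A graph class $\mathcal G$ is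 fractionally $p$-fragile if there is a function $f\colon\mathbb N\to\mathbb N$ such that, for every $r\in\mathbb N$, every $G\in\mathcal G$ has a $(1-1/r)$-general cover with $p$-width at most $f(r)$. *)

(* Defs.v *)
From HB Require Import structures.
From mathcomp Require Import all_boot all_order all_algebra.
From mathcomp Require Import boolp reals exp.

Set Implicit Arguments.
Unset Strict Implicit.
Unset Printing Implicit Defensive.

(* Possibly empty, so that G[A] and G - S are graphs for all vertex sets. *)
Record sgraph := SGraph {
  svertex :> finType;
  sedge : rel svertex;
  sedge_sym : symmetric sedge;
  sedge_irr : irreflexive sedge }.

Section Induced.
Variables (G : sgraph) (A : {set G}).

Definition induced_edge : rel {x : G | x \in A} :=
  fun x y => sedge (val x) (val y).

Lemma induced_sym : symmetric induced_edge.
Proof. by move=> x y; exact: sedge_sym. Qed.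

Lemma induced_irr : irreflexive induced_edge.
Proof. by move=> x; exact: sedge_irr. Qed.

Definition induced : sgraph := SGraph induced_sym induced_irr.
End Induced.

Definition isomorphic (G H : sgraph) : Prop :=
  exists2 f : G -> H, bijective f & {mono f : x y / sedge x y}.

Record graph_class := GraphClass {
  in_class :> sgraph -> Prop;
  class_nonempty : forall G, in_class G -> 0 < #|G|;
  class_iso : forall G H, isomorphic G H -> in_class G -> in_class H }.

Definition hereditary (C : graph_class) : Prop :=
  forall (G : sgraph) (A : {set G}), C G -> A != set0 -> C (induced A).

Definition stable (G : sgraph) (A : {set G}) : bool :=
  [forall x in A, forall y in A, ~~ sedge x y].

(* Independence number. *)
Definition alpha (G : sgraph) : nat := \max_(A : {set G} | stable A) #|A|.

Definition components (G : sgraph) : {set {set G}} :=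
  equivalence_partition (connect (@sedge G)) [set: G].

Definition balanced_separator (G : sgraph) (S : {set G}) : bool :=
  [forall K in components (induced (~: S)), 3 * #|K| <= 2 * #|G|].

Lemma balanced_separatorT (G : sgraph) : balanced_separator [set: G].
Proof.
apply/forall_inP => K _; rewrite (_ : #|K| = 0) ?muln0 //.
by apply: eq_card0 => -[x hx]; have := hx; rewrite in_setC in_setT.
Qed.

Definition sep (G : sgraph) : nat :=
  #|[arg min_(S < [set: G] | balanced_separator S) #|S|]|.

Definition sep_alpha (G : sgraph) : nat :=
  alpha (induced
    [arg min_(S < [set: G] | balanced_separator S) alpha (induced S)]).

Lemma sep_min (G : sgraph) :
  (exists2 S : {set G}, balanced_separator S & #|S| = sep G) /\
  (forall S : {set G}, balanced_separator S -> sep G <= #|S|).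
Proof.
rewrite /sep; case: arg_minnP => [|S bS minS]; first exact: balanced_separatorT.
by split; first by exists S.
Qed.

Lemma sep_alpha_min (G : sgraph) :
  (exists2 S : {set G}, balanced_separator S & alpha (induced S) = sep_alpha G) /\
  (forall S : {set G}, balanced_separator S -> sep_alpha G <= alpha (induced S)).
Proof.
rewrite /sep_alpha.
case: arg_minnP => [|S bS minS]; first exact: balanced_separatorT.
by split; first by exists S.
Qed.

Definition connected (G : sgraph) : Prop :=
  forall x y : G, connect (@sedge G) x y.

(* A closed walk x, y, x along one edge is a ucycle of size 2. *)
Definition acyclic (G : sgraph) : Prop :=
  forall c : seq G, ucycle (@sedge G) c -> size c <= 2.

Definition is_tree (T : sgraph) : Prop :=
  [/\ 0 < #|T|, connected T & acyclic T].

Definition tree_decomposition (G T : sgraph) (B : T -> {set G}) : Prop :=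
  [/\ is_tree T,
      forall v : G, exists t : T, v \in B t,
      forall u v : G, sedge u v -> exists t : T, (u \in B t) && (v \in B t)
    & forall v : G, connected (induced [set t : T | v \in B t])].

Lemma trivial_tree_decomposition (G : sgraph) :
  exists (T : sgraph) (B : T -> {set G}), tree_decomposition B.
Proof.
pose e : rel unit := fun _ _ => false.
have es : symmetric e by [].
have ei : irreflexive e by [].
exists (SGraph es ei), (fun=> [set: G]); split.
- split; first by rewrite card_unit.
  + by move=> [] []; exact: connect0.
  + case=> [|[] [|[] c]] //=.
- by move=> v; exists tt; rewrite inE.
- by move=> u v _; exists tt; rewrite !inE.
- by move=> v [[] ?] [[] ?]; apply/eq_connect0/val_inj.
Qed.

(* The value k is attained by a tree decomposition whose bags have maximal
   weight k. *)
Definition decomposition_value (G : sgraph) (w : {set G} -> nat) (k : nat) :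
    Prop :=
  exists (T : sgraph) (B : T -> {set G}),
    tree_decomposition B /\ \max_(t : T) w (B t) = k.

Lemma decomposition_value_ex (G : sgraph) (w : {set G} -> nat) :
  exists k, `[< decomposition_value w k >].
Proof.
have [T [B dB]] := trivial_tree_decomposition G.
by exists (\max_(t : T) w (B t)); apply/asboolP; exists T, B.
Qed.

Definition min_decomposition_value (G : sgraph) (w : {set G} -> nat) : nat :=
  ex_minn (decomposition_value_ex w).

(* The predecessor is truncated, so that tw is 0 on the empty graph. *)
Definition tw (G : sgraph) : nat :=
  (min_decomposition_value (fun X : {set G} => #|X|)).-1.

Definition tree_alpha (G : sgraph) : nat :=
  min_decomposition_value (fun X : {set G} => alpha (induced X)).

Local Open Scope ring_scope.

Definition strongly_sublinear (R : realType) (s : sgraph -> nat)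
    (C : graph_class) : Prop :=
  exists c eps : R, [/\ 1 <= c, 0 < eps &
    forall G : sgraph, C G -> (s G)%:R <= c * #|G|%:R `^ (1 - eps)].

(* Finite multisets of vertex sets are sequences, read up to order. *)
Definition general_cover (R : realType) (beta : R) (G : sgraph)
    (A : seq {set G}) : Prop :=
  (0 < size A)%N /\
  forall v : G, beta * (size A)%:R <= (count (fun X : {set G} => v \in X) A)%:R.

Definition cover_width (p : sgraph -> nat) (G : sgraph) (A : seq {set G}) :
    nat :=
  (\max_(X <- A) p (induced X))%N.

Definition fractionally_fragile (R : realType) (p : sgraph -> nat)
    (C : graph_class) : Prop :=
  exists f : nat -> nat, (forall r, (0 < r)%N -> (0 < f r)%N) /\
    forall r : nat, (0 < r)%N -> forall G : sgraph, C G ->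
      exists A : seq {set G},
        general_cover (1 - r%:R^-1 : R) A /\ (cover_width p A <= f r)%N.

(* Main.v *)
Require Import Defs.
From mathcomp Require Import all_boot all_order all_algebra.
From mathcomp Require Import boolp reals exp.
From mathcomp Require Import zify.

(** A clique on [n] vertices has no balanced separator with fewer than [n / 3]
    vertices, since deleting vertices from it leaves at most one component.
    Hence in a hereditary class with [sep G <= c * #|G| `^ (1 - eps)] a clique
    satisfies [n / 3 <= c * n `^ (1 - eps)], which bounds [n] by a constant [w]
    ([clique_bound]).  By Ramsey's theorem a vertex set without cliques of more
    than [w] vertices and with independence number [k] has fewer than
    ['C(w + k, w)] vertices ([ramsey_bin]).  Applied to the bags of a tree
    decomposition, this bounds treewidth by a function of the
    tree-independence number ([tw_le_tree_alpha]).

    Since moreover [sep_alpha <= sep], the class has strongly sublinear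
    separators in the independence sense, so the hypothesis provides covers of
    bounded tree-independence number; the very same covers have bounded
    treewidth. *)

Set Implicit Arguments.
Unset Strict Implicit.
Unset Printing Implicit Defensive.

Definition clique (G : sgraph) (A : {set G}) : bool :=
  [forall x in A, forall y in A, (x != y) ==> sedge x y].

Lemma cliqueP (G : sgraph) (A : {set G}) :
  reflect {in A &, forall x y, x != y -> sedge x y} (clique A).
Proof.
apply: (iffP forall_inP) => [cA x y xA yA | cA x xA].
  by move/forall_inP: (cA x xA) => /(_ y yA)/implyP.
by apply/forall_inP => y yA; apply/implyP; exact: cA.
Qed.

Lemma stableP (G : sgraph) (A : {set G}) :
  reflect {in A &, forall x y, ~~ sedge x y} (stable A).
Proof.
apply: (iffP forall_inP) => [cA x y xA yA | cA x xA].
  by move/forall_inP: (cA x xA) => /(_ y yA).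
by apply/forall_inP => y yA; exact: cA.
Qed.

Lemma cliqueU1 (G : sgraph) (v : G) (A : {set G}) :
  clique A -> {in A, forall x, sedge v x} -> clique (v |: A).
Proof.
move=> /cliqueP cA vA; apply/cliqueP => x y.
rewrite !inE => /predU1P[-> | xA] /predU1P[-> | yA].
- by rewrite eqxx.
- by rewrite vA.
- by rewrite sedge_sym vA.
- exact: cA.
Qed.

Lemma stableU1 (G : sgraph) (v : G) (A : {set G}) :
  stable A -> {in A, forall x, ~~ sedge v x} -> stable (v |: A).
Proof.
move=> /stableP cA vA; apply/stableP => x y.
rewrite !inE => /predU1P[-> | xA] /predU1P[-> | yA].
- by rewrite sedge_irr.
- by rewrite vA.
- by rewrite sedge_sym vA.
- exact: cA.
Qed.

(** The Erdos-Szekeres bound: among the neighbours of a vertex [v] cliques are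
    smaller by one, as [v] extends them, and among its non-neighbours the same
    holds for stable sets; Pascal's rule adds up the two bounds. *)
Lemma ramsey_bin (G : sgraph) (w k : nat) (X : {set G}) :
  (forall K : {set G}, K \subset X -> clique K -> #|K| <= w) ->
  (forall S : {set G}, S \subset X -> stable S -> #|S| <= k) ->
  #|X| < 'C(w + k, w).
Proof.
have [n] := ubnP #|X|; elim: n X w k => // n IHn X w k ltXn clX stX.
have [-> | [v vX]] := set_0Vmem X.
  by rewrite cards0 bin_gt0 leq_addr.
have sv : [set v] \subset X by rewrite sub1set.
have cl1 : clique [set v].
  by apply/cliqueP => x y /set1P-> /set1P->; rewrite eqxx.
have st1 : stable [set v].
  by apply/stableP => x y /set1P-> /set1P->; rewrite sedge_irr.
have w_gt0 := clX _ sv cl1; have k_gt0 := stX _ sv st1.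
rewrite cards1 in w_gt0 k_gt0.
case: w => // w in clX w_gt0 *; case: k => // k in stX k_gt0 *.
set N := [set x in X :\ v | sedge v x].
set M := [set x in X :\ v | ~~ sedge v x].
have sNX : N \subset X :\ v by apply/subsetP => x; rewrite inE => /andP[].
have sMX : M \subset X :\ v by apply/subsetP => x; rewrite inE => /andP[].
have cardX : #|X| = (#|N| + #|M|).+1.
  rewrite (cardsD1 v X) vX add1n -(cardsID [set x | sedge v x] (X :\ v)).
  by congr (_ + _).+1; apply: eq_card => x; rewrite !inE // andbC.
have extend (S : {set G}) : S \subset X :\ v ->
  v |: S \subset X /\ #|v |: S| = #|S|.+1.
  rewrite subsetD1 => /andP[sSX vS].
  by rewrite subUset sv sSX cardsU1 vS.
have ltN : #|N| < 'C(w + k.+1, w).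
  apply: IHn => [|K sKN clK|S sSN]; first by lia.
  - have [sK cK] := extend K (subset_trans sKN sNX).
    rewrite -ltnS -cK; apply: clX => //; apply: cliqueU1 => // x /(subsetP sKN).
    by rewrite inE => /andP[].
  - by apply: stX; apply: subset_trans sSN (subset_trans sNX (subsetDl _ _)).
have ltM : #|M| < 'C(w.+1 + k, w.+1).
  apply: IHn => [|K sKM|S sSM stS]; first by lia.
  - by apply: clX; apply: subset_trans sKM (subset_trans sMX (subsetDl _ _)).
  - have [sS cS] := extend S (subset_trans sSM sMX).
    rewrite -ltnS -cS; apply: stX => //; apply: stableU1 => // x /(subsetP sSM).
    by rewrite inE => /andP[].
by rewrite addnS binS cardX addSn; move: ltN ltM; rewrite addnS addSn; lia.
Qed.

Lemma alpha_le_card (G : sgraph) : alpha G <= #|G|.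
Proof. by apply/bigmax_leqP => A _; exact: max_card. Qed.

Lemma card_induced (G : sgraph) (A : {set G}) : #|induced A| = #|A|.
Proof. by rewrite card_sig; apply: eq_card => x. Qed.

Lemma stable_le_alpha (G : sgraph) (X S : {set G}) :
  S \subset X -> stable S -> #|S| <= alpha (induced X).
Proof.
move=> /subsetP sSX /stableP stS.
pose S' : {set induced X} := [set x | val x \in S].
have <- : #|S'| = #|S|.
  rewrite -(card_imset (mem S') val_inj); apply: eq_card => x.
  apply/imsetP/idP => [[y] | xS]; first by rewrite inE => ? ->.
  by exists (Sub x (sSX x xS)); rewrite ?inE.
apply: leq_bigmax_cond; apply/stableP => x y; rewrite !inE; exact: stS.
Qed.

Lemma sep_alpha_le_sep (G : sgraph) : sep_alpha G <= sep G.
Proof.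
have [[S bS <-] _] := sep_min G; have [_ minS] := sep_alpha_min G.
apply: leq_trans (minS S bS) _.
by rewrite -(card_induced S); exact: alpha_le_card.
Qed.

Lemma clique_induced (G : sgraph) (K : {set G}) :
  clique K -> clique [set: induced K].
Proof.
move=> /cliqueP clK; apply/cliqueP => x y _ _ xy.
exact: clK (valP x) (valP y) xy.
Qed.

Lemma clique_val (G : sgraph) (A : {set G}) (K : {set induced A}) :
  clique K -> clique (val @: K).
Proof.
move=> /cliqueP clK; apply/cliqueP => _ _ /imsetP[x xK ->] /imsetP[y yK ->] xy.
by apply: clK xK yK _; apply: contra_neq xy => ->.
Qed.

Lemma complete_sep (G : sgraph) : clique [set: G] -> #|G| <= 3 * sep G.
Proof.
move=> /cliqueP clG; have [[S bS <-] _] := sep_min G.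
have [n1 | [v vS]] := set_0Vmem (~: S).
  by have := cardsC S; rewrite n1 cards0; lia.
pose H := induced (~: S); pose x0 : H := Sub v vS.
have connH (x y : H) : connect (@sedge H) x y.
  have [-> // | xy] := eqVneq x y.
  by apply: connect1; apply: clG.
have HK : [set: H] \in components H.
  apply/imsetP; exists x0 => //; apply/setP => x; rewrite !inE.
  by rewrite connH.
move/forall_inP: bS => /(_ _ HK); rewrite cardsT card_induced.
by have := cardsC S; lia.
Qed.

(** The decomposition that is optimal for the tree-independence number is
    reused: with cliques bounded, Ramsey's theorem turns small independence
    number of a bag into small size. *)
Lemma tw_le_tree_alpha (G : sgraph) (w : nat) :
  (forall K : {set G}, clique K -> #|K| <= w) ->
  tw G <= 'C(w + tree_alpha G, w).
Proof.
move=> clG; rewrite /tree_alpha /min_decomposition_value.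
case: ex_minnP => k /asboolP[T [B [dB maxB]]] _.
have bagB (t : T) : #|B t| <= 'C(w + k, w).
  apply/ltnW/ramsey_bin => [K _|S sS stS]; first exact: clG.
  apply: leq_trans (stable_le_alpha sS stS) _.
  by rewrite -maxB; exact: (leq_bigmax t).
rewrite /tw /min_decomposition_value; case: ex_minnP => m _ minm.
apply: leq_trans (leq_pred m) _.
apply: (leq_trans (minm (\max_(t : T) #|B t|) _)).
  by apply/asboolP; exists T, B.
by apply/bigmax_leqP => t _.
Qed.

Import Order.TTheory GRing.Theory Num.Theory.
Local Open Scope ring_scope.

(** Dividing by [x `^ (1 - eps)] gives [x `^ eps <= b]; this is also valid for
    [eps > 1]. *)
Lemma powR_sublinear_bound (R : realType) (b eps x : R) :
  0 < eps -> 0 < x -> x <= b * x `^ (1 - eps) -> x <= b `^ eps^-1.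
Proof.
move=> eps_gt0 x_gt0 xb.
have xeb : x `^ eps <= b.
  rewrite -(ler_pM2r (powR_gt0 (1 - eps) x_gt0)) -powRD.
    by rewrite subrKC powRr1 // ltW.
  by apply/implyP => _; rewrite gt_eqF.
rewrite -[leLHS](powRr1 (ltW x_gt0)) -(divff (lt0r_neq0 eps_gt0)) powRrM.
apply: ge0_ler_powR; rewrite ?nnegrE ?invr_ge0 ?powR_ge0 //; first exact: ltW.
exact: le_trans (powR_ge0 _ _) xeb.
Qed.

Lemma clique_bound (R : realType) (C : graph_class) :
  hereditary C -> strongly_sublinear R sep C ->
  exists w : nat, forall (G : sgraph) (K : {set G}),
    C G -> clique K -> (#|K| <= w)%N.
Proof.
move=> hC [c [eps [c_ge1 eps_gt0 sepC]]].
exists (Num.truncn ((3 * c) `^ eps^-1)) => G K CG clK.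
have [-> | K_neq0] := eqVneq K set0; first by rewrite cards0.
rewrite truncn_ge_nat ?powR_ge0 //; apply: powR_sublinear_bound => //.
  by rewrite ltr0n card_gt0.
rewrite -mulrA -(card_induced K).
apply: le_trans (_ : (3 * sep (induced K))%:R <= _).
  by rewrite ler_nat; apply/complete_sep/clique_induced.
by rewrite natrM ler_pM2l //; apply/sepC/hC.
Qed.

Theorem lemma1p5 (R : realType) :
  (forall C : graph_class, hereditary C -> strongly_sublinear R sep_alpha C ->
     fractionally_fragile R tree_alpha C) ->
  forall C : graph_class, hereditary C -> strongly_sublinear R sep C ->
    fractionally_fragile R tw C.
Proof.
move=> alphaP C hC sC; have [w clC] := clique_bound hC sC.
have [|f [_ fragC]] := alphaP C hC.
  case: sC => c [eps [c_ge1 eps_gt0 sepC]]; exists c, eps; split=> // G CG.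
  by apply: le_trans (sepC G CG); rewrite ler_nat sep_alpha_le_sep.
exists (fun r => 'C(w + f r, w)); split=> [r _ | r r_gt0 G CG].
  by rewrite bin_gt0 leq_addr.
have [A [covA widthA]] := fragC r r_gt0 G CG; exists A; split=> //.
rewrite /cover_width; apply/bigmax_leqP_seq => X XA _.
apply: (@leq_trans 'C(w + tree_alpha (induced X), w)).
  apply: tw_le_tree_alpha => K clK.
  by rewrite -(card_imset (mem K) val_inj); apply: clC CG (clique_val clK).
apply/leq_bin2l; rewrite leq_add2l; apply: leq_trans widthA.
exact: (@leq_bigmax_seq _ A xpredT (fun Y : {set G} => tree_alpha (induced Y))).
Qed.
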